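(* For all positive integers $n$ and non-negative integers $k$, we have $$\det_{0\le i,j\le n-1}\left(\mathcal P_{j}(i,k)-t(xy)^{i+1}\mathcal P_{j}(-i-2,k)\right)=\begin{cases} (-1)^{n_1\binom{k+1}2}\,t^{k\lfloor n_1/2\rfloor}(xy)^{(k+1)^2\binom{n_1}2} & \text{if } n=n_1(k+1) \text{ with } n_1 \text{ an integer},\\ 0 & \text{if } n\not\equiv 0\pmod{k+1},\end{cases}$$ while for $k=-1$ we have $$\det_{0\le i,j\le n-1}\left(\mathcal P_{j}(i,-1)-t(xy)^{i+1}\mathcal P_{j}(-i-2,-1)\right)=0.$$
   Context: $x,y,t$ are indeterminates. A three-step path is a lattice path in $\mathbb Z^2$ consisting of steps from $\{(1,0),(1,1),(1,-1)\}$. The steps have weights $w((1,0))=x+y$, $w((1,1))=1$, $w((1,-1))=xy$, and the weight $w(P)$ of a path $P$ is the product of the weights of its steps (the empty path has weight $1$). For integers $n\ge 0$ and $l,k$ (possibly negative), $\mathcal P_n(l,k)=\sum_P w(P)$, where the sum is over all three-step paths $P$ from $(0,l)$ to $(n,k)$ (with no restriction about the $x$-axis). For $k=0$ only the first case on the right-hand side of the first formula applies. In the matrices, $i$ is the row index and $j$ the column index. *)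

(* Defs.v *)
From HB Require Import structures.
From mathcomp Require Import all_boot all_order all_algebra.
From mathcomp Require Import mpoly.

Set Implicit Arguments.
Unset Strict Implicit.
Unset Printing Implicit Defensive.

Import Order.TTheory GRing.Theory Num.Theory.
Local Open Scope ring_scope.

Definition steps : seq (int * int) := [:: (1, 0); (1, 1); (1, -1)].

Definition step : finType := seq_sub steps.

Definition step_weight (R : comNzRingType) (x y : R) (s : step) : R :=
  if val s == (1, 0) then x + y else if val s == (1, 1) then 1 else x * y.

Definition path_weight (R : comNzRingType) (x y : R) (n : nat)
    (p : n.-tuple step) : R :=
  \prod_(s <- p) step_weight x y s.

Definition path_end (n : nat) (a : int * int) (p : n.-tuple step) : int * int :=
  a + \sum_(s <- p) val s.

(* Every step increases the abscissa by 1, so a path from (0, l) to (n, k) has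
   exactly n steps, and summing over n-tuples of steps misses no path. *)
Definition path_sum (R : comNzRingType) (x y : R) (n : nat) (l k : int) : R :=
  \sum_(p : n.-tuple step | path_end (0, l) p == (n%:Z, k)) path_weight x y p.

Definition path_mx (R : comNzRingType) (x y t : R) (n : nat) (k : int) : 'M[R]_n :=
  \matrix_(i < n, j < n)
    (path_sum x y j i%:Z k
     - t * (x * y) ^+ i.+1 * path_sum x y j (- i%:Z - 2) k).

(* Main.v *)
(* With q = x y and L = z + (x + y) + q / z, path_sum x y j l k is the
   coefficient of z^(k - l) in L^j. Since L is invariant under z -> q / z, L^j is
   a unitriangular combination of 1 and the z^s + q^s z^(-s) with 0 < s <= j;
   column operations therefore turn the matrix into one with at most two nonzero
   entries per column. For the reduced matrix of size m + 2 (k + 1), each of the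
   last k + 2 rows has a single nonzero entry, and once these rows and the
   corresponding columns are deleted, so has each of the last k columns; what
   remains is the reduced matrix of size m. *)

Require Import Defs.
From HB Require Import structures.
From mathcomp Require Import all_boot all_order all_algebra.
From mathcomp Require Import mpoly zify ring.

Set Implicit Arguments.
Unset Strict Implicit.
Unset Printing Implicit Defensive.

Import Order.TTheory GRing.Theory Num.Theory.
Local Open Scope ring_scope.

(** * Path sums and the passage to symmetric Laurent polynomials *)

Lemma sum_step (V : nmodType) (F : int * int -> V) :
  \sum_(s : step) F (val s) = F (1, 0) + F (1, 1) + F (1, -1).
Proof.
rewrite -(big_map val xpredT F) /index_enum !unlock /= val_seq_sub_enum //.
by rewrite /= addr0 addrA.
Qed.

Section PathSum.
Variables (R : comNzRingType) (x y : R).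

Lemma path_sum0 (l k : int) : path_sum x y 0 l k = (l == k)%:R.
Proof.
rewrite /path_sum big_mkcond (big_pred1 [tuple]) => [|p]; last by rewrite (tuple0 p) /= eqxx.
by rewrite /path_end /path_weight !big_nil addr0 xpair_eqE eqxx /=; case: eqP.
Qed.

(** A path is split at its first step; the rest, translated back to abscissa 0, starts at height
    [l], [l + 1] or [l - 1]. *)
Lemma path_sumS (n : nat) (l k : int) :
  path_sum x y n.+1 l k =
    (x + y) * path_sum x y n l k + path_sum x y n (l + 1) k
    + x * y * path_sum x y n (l - 1) k.
Proof.
pose cons_step (p : step * n.-tuple step) := [tuple of p.1 :: p.2].
rewrite {1}/path_sum (reindex cons_step) /=; last first.
  exists (fun p => (thead p, [tuple of behead p])) => p _ /=.
    by case: p => s p; rewrite theadE; congr (_, _); apply: val_inj.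
  by rewrite /cons_step [RHS]tuple_eta; apply: val_inj.
pose w (d : int * int) := if d == (1, 0) then x + y else if d == (1, 1) then 1 else x * y.
transitivity (\sum_(s : step) w (val s) * path_sum x y n (l + (val s).2) k); last first.
  by rewrite (sum_step (fun d => w d * path_sum x y n (l + d.2) k)) /w /= addr0 mul1r.
under [RHS]eq_bigr do rewrite big_distrr.
rewrite pair_big_dep /=; apply: eq_big => [[s p]|[s p] _] /=; last first.
  by rewrite /path_weight big_cons.
have: (val s).1 = 1.
  by have := valP s; rewrite !inE => /or3P[]/eqP->.
have addE (a b : int * int) : a + b = (a.1 + b.1, a.2 + b.2) by [].
rewrite /path_end big_cons !addE !xpair_eqE /= => ->; congr andb; last by rewrite addrA.
by rewrite !add0r -addn1 PoszD addrC (inj_eq (addIr _)).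
Qed.

Lemma path_sum_trans (n : nat) (l k : int) :
  path_sum x y n l k = path_sum x y n 0 (k - l).
Proof.
elim: n l k => [|n IH] l k; first by rewrite !path_sum0 eq_sym -subr_eq0 eq_sym.
rewrite !path_sumS !(IH _ k) (IH (0 + 1)) (IH (0 - 1)).
by do 3?congr (_ + _); congr (_ * _ ) || idtac; congr path_sum; ring.
Qed.

(** This is the invariance of L^n under z -> q / z, read coefficient by coefficient; the recurrence
    preserves it. *)
Lemma path_sum_sym (n s : nat) :
  path_sum x y n 0 (- s%:Z) = (x * y) ^+ s * path_sum x y n 0 s.
Proof.
elim: n s => [|n IH] s.
  by rewrite !path_sum0; case: s => [|s]; rewrite ?mul1r ?mulr0.
case: s => [|s]; first by rewrite oppr0 mul1r.
rewrite !path_sumS !(path_sum_trans _ (_ + _)) IH.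
have -> : - s.+1%:Z - (0 + 1) = - s.+2%:Z by lia.
have -> : - s.+1%:Z - (0 - 1) = - s%:Z by lia.
have -> : s.+1%:Z - (0 + 1) = s%:Z by lia.
have -> : s.+1%:Z - (0 - 1) = s.+2%:Z by lia.
by rewrite !IH !exprS; ring.
Qed.

Lemma path_sum_gt (n : nat) (m : int) : n%:Z < m -> path_sum x y n 0 m = 0.
Proof.
elim: n m => [|n IH] m lt_nm; first by rewrite path_sum0; case: eqP => // E; lia.
rewrite path_sumS !(path_sum_trans _ (_ + _)) !IH ?mulr0 ?addr0 //; lia.
Qed.

Lemma path_sum_diag (n : nat) : path_sum x y n 0 n = 1.
Proof.
elim: n => [|n IH]; first by rewrite path_sum0.
rewrite path_sumS !(path_sum_trans _ (_ + _)).
have -> : n.+1%:Z - (0 + 1) = n by lia.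
rewrite IH !path_sum_gt ?mulr0 ?addr0 ?add0r //; lia.
Qed.

(* The coefficient of z^m in z^s + q^s z^(-s), or in 1 if s = 0. *)
Definition sym_coef (q : R) (s : nat) (m : int) : R :=
  (m == s%:Z)%:R + ((0 < s)%N && (m == - s%:Z))%:R * q ^+ s.

(** By symmetry the coefficients of L^j at z^s with s >= 0 are its coordinates in the basis 1, z^s +
    q^s z^(-s). They vanish for s > j, so [j < n] keeps them all in the sum. *)
Lemma path_sum_sym_coef (n j : nat) (m : int) : (j < n)%N ->
  path_sum x y j 0 m = \sum_(s < n) sym_coef (x * y) s m * path_sum x y j 0 s.
Proof.
move=> lt_jn.
have sum_delta (a : nat) (F : nat -> R) :
    (forall s, (n <= s)%N -> F s = 0) -> \sum_(s < n) (a == s)%:R * F s = F a.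
  move=> F0; case: (ltnP a n) => [lt_an|le_na]; last first.
    by rewrite F0 // big1 // => s _; rewrite gtn_eqF ?mul0r // (leq_trans _ le_na).
  rewrite (bigD1 (Ordinal lt_an)) //= eqxx mul1r big1 ?addr0 // => s.
  by rewrite -val_eqE /= eq_sym => /negPf ->; rewrite mul0r.
have c0 s : (n <= s)%N -> path_sum x y j 0 s = 0.
  by move=> le_ns; apply: path_sum_gt; lia.
case: m => a.
  rewrite -[LHS](sum_delta a (fun s => path_sum x y j 0 s)) //.
  apply: eq_bigr => s _; congr (_ * _); rewrite /sym_coef.
  have -> : (0 < s)%N && (Posz a == - s%:Z) = false by lia.
  by rewrite mul0r addr0.
rewrite NegzE path_sum_sym.
rewrite -[LHS](sum_delta a.+1 (fun s => (x * y) ^+ s * path_sum x y j 0 s)); last first.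
  by move=> s /c0 ->; rewrite mulr0.
apply: eq_bigr => s _; rewrite mulrA /sym_coef.
have -> : (0 < s)%N && (- a.+1%:Z == - s%:Z) = (a.+1 == s) by lia.
have -> : (- a.+1%:Z == s%:Z) = false by lia.
by rewrite add0r.
Qed.

Lemma det_path_mx (t : R) (n : nat) (k : int) :
  \det (path_mx x y t n k) =
    \det (\matrix_(i < n, s < n)
            (sym_coef (x * y) s (k - i%:Z)
             - t * (x * y) ^+ i.+1 * sym_coef (x * y) s (k + i%:Z + 2))).
Proof.
(* Column [j] of [B] holds the coordinates of L^j. [B] is upper unitriangular because L^j has top
   term z^j with coefficient 1, and the path matrix is the right-hand matrix times [B]. *)
pose B : 'M[R]_n := \matrix_(s < n, j < n) path_sum x y j 0 s.
have detB : \det B = 1.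
  rewrite -det_tr det_trig; last first.
    by apply/is_trig_mxP => j s lt_js; rewrite !mxE path_sum_gt.
  by apply: big1 => s _; rewrite !mxE path_sum_diag.
rewrite -[RHS]mulr1 -detB -det_mulmx; congr (\det _); apply/matrixP => i j.
rewrite !mxE !(path_sum_trans _ _ k) (_ : k - (- i%:Z - 2) = k + i%:Z + 2); last by ring.
rewrite !(path_sum_sym_coef _ (ltn_ord j)) mulr_sumr -sumrB.
by apply: eq_bigr => s _; rewrite !mxE mulrBl mulrA.
Qed.
End PathSum.

(** * Determinants of sparse matrices *)

(** With indices in [nat], deleting rows and columns only reindexes [F], and sizes are rewritten
    without casts. *)
Definition nat_mx (R : comNzRingType) (n : nat) (F : nat -> nat -> R) : 'M[R]_n :=
  \matrix_(i < n, j < n) F i j.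

(** Repeated expansion along the last row: the last [b] rows form a diagonal block in columns [c] to
    [c + b - 1] and vanish elsewhere. *)
Lemma det_nat_mx_last_rows (R : comNzRingType) (r b c : nat)
    (F : nat -> nat -> R) (d : nat -> R) : (c <= r)%N ->
  (forall i j, (i < b)%N -> (j < r + b)%N -> F (r + i)%N j = (j == c + i)%:R * d i) ->
  \det (nat_mx (r + b) F) =
    (-1) ^+ ((r - c) * b) * (\prod_(i < b) d i)
    * \det (nat_mx r (fun i j => F i (if (j < c)%N then j else j + b)%N)).
Proof.
move=> le_cr; elim: b F => [|b IH] F Fd.
  rewrite muln0 big_ord0 !mul1r addn0; congr (\det _); apply/matrixP => i j.
  by rewrite !mxE addn0 if_same.
have lt_cb : (c + b < (r + b).+1)%N by lia.
rewrite addnS (expand_det_row _ ord_max) (bigD1 (Ordinal lt_cb)) //= [X in _ + X]big1.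
  rewrite addr0 mxE /= Fd ?ltnS ?addnS // eqxx mul1r /cofactor.
  have -> : row' ord_max (col' (Ordinal lt_cb) (nat_mx (r + b).+1 F))
      = nat_mx (r + b) (fun i j => F i (bump (c + b) j)).
    by apply/matrixP => i j; rewrite !mxE lift_max.
  rewrite IH => [|i j lt_ib lt_j]; last first.
    rewrite Fd; [congr (_%:R * _)| lia | by rewrite /bump; lia].
    congr nat_of_bool; rewrite /bump. lia.
  rewrite big_ord_recr /=.
  have -> : nat_mx r (fun i j => F i (bump (c + b) (if j < c then j else j + b)%N))
      = nat_mx r (fun i j => F i (if j < c then j else j + b.+1)%N).
    apply/matrixP => i j; rewrite !mxE; congr F; rewrite /bump; case: ltnP; lia.
  (* The pivot sits in row r + b and column c + b, so each expansion contributes a sign of parity r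
     - c. *)
  have -> : (-1) ^+ (r + b + (c + b)) = (-1) ^+ (r - c) :> R.
    by rewrite -[LHS]signr_odd -[RHS]signr_odd; congr (_ ^+ nat_of_bool _); lia.
  by rewrite mulnS exprD; ring.
move=> j /negPf ne_j; rewrite mxE /= Fd ?ltnS ?addnS //.
by move: ne_j; rewrite -val_eqE /= => ->; rewrite !mul0r.
Qed.

Lemma det_nat_mx_lblock (R : comNzRingType) (m k : nat) (F : nat -> nat -> R) (d : nat -> R) :
  (forall i j, (i < m)%N -> (j < k)%N -> F i (m + j)%N = 0) ->
  (forall i j, (i < k)%N -> (j < k)%N -> F (m + i)%N (m + j)%N = (i == j)%:R * d i) ->
  \det (nat_mx (m + k) F) = \det (nat_mx m F) * \prod_(i < k) d i.
Proof.
move=> F0 Fd; rewrite -[nat_mx (m + k) F]submxK.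
have -> : ursubmx (nat_mx (m + k) F) = 0.
  by apply/matrixP => i j; rewrite !mxE /= F0.
rewrite det_lblock; congr (\det _ * _).
  by apply/matrixP => i j; rewrite !mxE.
rewrite det_trig => [|].
  by apply: eq_bigr => i _; rewrite !mxE /= Fd // eqxx mul1r.
by apply/is_trig_mxP => i j lt_ij; rewrite !mxE /= Fd // ltn_eqF // mul0r.
Qed.

(** Passing from size n to n + 1, the last row has its single 1 in column 0, which gives the sign
    (-1)^n. *)
Lemma det_antidiag (R : comNzRingType) (n : nat) :
  \det (nat_mx n (fun i j => (i + j.+1 == n)%N%:R)) = (-1) ^+ 'C(n, 2) :> R.
Proof.
elim: n => [|n IH]; first by rewrite det_mx00.
rewrite (expand_det_row _ ord_max) (bigD1 ord0) //= big1 => [|j].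
  rewrite addr0 mxE /= addn1 eqxx mul1r /cofactor addn0 binS bin1 exprD -IH mulrC.
  congr (\det _ * _); apply/matrixP => i j; rewrite !mxE /= /bump leq0n add1n.
  by rewrite leqNgt ltn_ord add0n addnS eqSS.
rewrite -val_eqE mxE /= => j_neq0.
have -> : (n + j.+1 == n.+1)%N = false by lia.
by rewrite mul0r.
Qed.

Lemma prodr_exprD (R : comNzRingType) (q : R) (m n : nat) :
  \prod_(i < n) q ^+ (m + i) = q ^+ (n * m + 'C(n, 2)).
Proof.
elim: n => [|n IH]; first by rewrite big_ord0.
by rewrite big_ord_recr /= IH -exprD binS bin1; congr (_ ^+ _); lia.
Qed.

(** * Evaluation of the reduced determinant *)

Section Reduced.
Variables (R : comNzRingType) (q t : R) (k : nat).

(* The matrix of det_path_mx for k >= 0; the test 0 < s avoids counting the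
   entry (k, 0) twice. *)
Definition reduced (i s : nat) : R :=
  (i + s == k)%N%:R + ((0 < s)%N && (i == s + k)%N)%:R * q ^+ s
  - t * q ^+ i.+1 * (s == i + k + 2)%N%:R.

(** Rows i from m + k on have the single entry q^s at s = i - k, which uses up columns m to m + k +
    1. Each later column s then has the single entry -t q^(i+1), in row i = s - k - 2. *)
Lemma reduced_det_add (m : nat) :
  \det (nat_mx (m + k.+1.*2) reduced) =
    t ^+ k * q ^+ (k.+1.*2 * m + k.+1 ^ 2) * \det (nat_mx m reduced).
Proof.
have -> : (m + k.+1.*2 = m + k + k.+2)%N by lia.
have -> : t ^+ k * q ^+ (k.+1.*2 * m + k.+1 ^ 2) =
    (-1) ^+ ((m + k - m) * k.+2) * \prod_(i < k.+2) q ^+ (m + i)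
    * \prod_(i < k) (- (t * q ^+ (m + i).+1)).
  have -> : \prod_(i < k) (- (t * q ^+ (m + i).+1))
      = (- t) ^+ k * q ^+ (k * m.+1 + 'C(k, 2)).
    under eq_bigr do rewrite -mulNr -addSn.
    by rewrite big_split prodr_exprD prodr_const card_ord.
  (* The sign (-1)^(k(k+2)) of the row expansions equals (-1)^k and cancels the sign of (-t)^k. *)
  rewrite addKn prodr_exprD [(- t) ^+ k]exprNn.
  have -> : (-1) ^+ (k * k.+2) = (-1) ^+ k :> R.
    by rewrite -[LHS]signr_odd -[RHS]signr_odd oddM /= negbK andbb.
  have -> : (k.+1.*2 * m + k.+1 ^ 2 = k.+2 * m + 'C(k.+2, 2) + (k * m.+1 + 'C(k, 2)))%N.
    have bin2k : ('C(k, 2).*2 + k = k ^ 2)%N.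
      by elim: (k) => [|j IH]; rewrite // binS bin1 doubleD; nia.
    by rewrite !binS !bin0 !bin1; nia.
  have := sqrr_sign R k; move: ((-1) ^+ k) => e e2.
  by rewrite exprD -[LHS]mul1r -e2; ring.
rewrite (det_nat_mx_last_rows (c := m) (d := fun i => q ^+ (m + i))) ?leq_addr //.
  rewrite (det_nat_mx_lblock (d := fun i => - (t * q ^+ (m + i).+1))).
  - rewrite -!mulrA [X in _ * (_ * X)]mulrC; do 3?congr (_ * _).
    by congr (\det _); apply/matrixP => i j; rewrite !mxE ltn_ord.
  - move=> i j lt_im lt_jk; rewrite ltnNge leq_addr /= /reduced.
    have -> : (i + (m + j + k.+2) == k)%N = false by lia.
    have -> : (i == m + j + k.+2 + k)%N = false by lia.
    have -> : (m + j + k.+2 == i + k + 2)%N = false by lia.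
    rewrite andbF /=; ring.
  - move=> i j lt_ik lt_jk; rewrite ltnNge leq_addr /= /reduced.
    have -> : (m + i + (m + j + k.+2) == k)%N = false by lia.
    have -> : (m + i == m + j + k.+2 + k)%N = false by lia.
    have -> : (m + j + k.+2 == m + i + k + 2)%N = (i == j) by lia.
    rewrite andbF /=; ring.
move=> i j lt_i lt_j; rewrite /reduced.
have -> : (j == m + k + i + k + 2)%N = false by lia.
(* In column 0 the entry comes from the first summand of [reduced]; it is nonzero only if m + i = 0,
   where 1 = q^0 has the required form. *)
rewrite mulr0 subr0; case: (posnP j) => [-> | j_gt0].
  have -> : (m + k + i + 0 == k)%N = (0 == m + i)%N by lia.
  by case: eqP => [<-|_] /=; rewrite ?mul0r ?mul1r addr0.
have -> : (m + k + i + j == k)%N = false by lia.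
have -> : (m + k + i == j + k)%N = (j == m + i)%N by lia.
by rewrite add0r; case: eqP => [->|_] //=; rewrite !mul0r.
Qed.

Lemma reduced_det_lt (n : nat) : (0 < n < k.+1.*2)%N -> n != k.+1 ->
  \det (nat_mx n reduced) = 0.
Proof.
move=> n_bd n_ne.
have [j lt_jn colj] : exists2 j, (j < n)%N & forall i, (i < n)%N -> reduced i j = 0.
  (* A zero column: the only nonzero entry of column 0 is in row k, and that of column k + 1 in row
     2k + 1, both outside the matrix in the respective case. *)
  exists (if n < k.+1 then 0 else k.+1)%N; first by case: ifP; lia.
  move=> i lt_in; rewrite /reduced; set j := if _ then _ else _.
  have -> : (i + j == k)%N = false by rewrite /j; case: ifP; lia.
  have -> : (0 < j)%N && (i == j + k)%N = false by rewrite /j; case: ifP; lia.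
  have -> : (j == i + k + 2)%N = false by rewrite /j; case: ifP; lia.
  by rewrite mul0r mulr0 addr0 subr0.
rewrite (expand_det_col _ (Ordinal lt_jn)) big1 // => i _.
by rewrite mxE /= colj ?mul0r.
Qed.

(** At this size only the entries with i + s = k survive. *)
Lemma reduced_det_diag : \det (nat_mx k.+1 reduced) = (-1) ^+ 'C(k.+1, 2).
Proof.
rewrite -det_antidiag; congr (\det _); apply/matrixP => i j; rewrite !mxE /reduced.
have := ltn_ord i; have := ltn_ord j => lt_j lt_i.
have -> : (0 < j)%N && (i == j + k :> nat)%N = false by lia.
have -> : (j == i + k + 2 :> nat)%N = false by lia.
by rewrite addnS eqSS mul0r mulr0 addr0 subr0.
Qed.

Lemma reduced_det_mul (n1 : nat) :
  \det (nat_mx (n1 * k.+1) reduced) =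
    (-1) ^+ (n1 * 'C(k.+1, 2)) * t ^+ (k * n1./2) * q ^+ (k.+1 ^ 2 * 'C(n1, 2)).
Proof.
(* Removing 2(k + 1) rows lowers [n1] by 2, so the induction carries two consecutive values. *)
suff H : forall m, let D n1 := \det (nat_mx (n1 * k.+1) reduced) =
    (-1) ^+ (n1 * 'C(k.+1, 2)) * t ^+ (k * n1./2) * q ^+ (k.+1 ^ 2 * 'C(n1, 2)) in
    D m /\ D m.+1 by case: (H n1).
elim=> [|m [IH0 IH1]] /=.
  split; first by rewrite det_mx00 /= !muln0 !mul1r.
  by rewrite !mul1n reduced_det_diag !muln0 !mulr1.
split=> //.
have -> : (m.+2 * k.+1 = m * k.+1 + k.+1.*2)%N by lia.
rewrite reduced_det_add IH0 /=.
have -> : (k.+1 ^ 2 * 'C(m.+2, 2) = k.+1.*2 * (m * k.+1) + k.+1 ^ 2 + k.+1 ^ 2 * 'C(m, 2))%N.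
  by rewrite !binS !bin0 !bin1; nia.
have -> : (-1) ^+ (m.+2 * 'C(k.+1, 2)) = (-1) ^+ (m * 'C(k.+1, 2)) :> R.
  by rewrite -[LHS]signr_odd -[RHS]signr_odd !oddM /= negbK.
by rewrite [(k * _.+1)%N]mulnS (exprD q (_ + _)%N) (exprD t); ring.
Qed.

(** Subtracting 2(k + 1) preserves non-divisibility by k + 1 and ends at a size where some column is
    zero. *)
Lemma reduced_det_ndvd (n : nat) : ~~ (k.+1 %| n)%N -> \det (nat_mx n reduced) = 0.
Proof.
elim/ltn_ind: n => n IH ndvd.
case: (ltnP n k.+1.*2) => [lt_n|le_n].
  apply: reduced_det_lt; last by apply: contraNneq ndvd => ->.
  by rewrite lt_n andbT lt0n; apply: contraNneq ndvd => ->.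
rewrite -(subnK le_n) reduced_det_add IH ?mulr0 //; first by lia.
by rewrite dvdn_subl // -muln2 dvdn_mulr.
Qed.
End Reduced.

(** * Return to the path matrix *)

Lemma det_path_mx_nat (R : comNzRingType) (x y t : R) (n k : nat) :
  \det (path_mx x y t n k) = \det (nat_mx n (reduced (x * y) t k)).
Proof.
rewrite det_path_mx; congr (\det _); apply/matrixP => i s; rewrite !mxE /sym_coef /reduced.
have -> : (k%:Z - i%:Z == s%:Z) = (i + s == k)%N by lia.
have -> : (k%:Z - i%:Z == - s%:Z) = (i == s + k :> nat)%N by lia.
have -> : (k%:Z + i%:Z + 2 == s%:Z) = (s == i + k + 2 :> nat)%N by lia.
have -> : (k%:Z + i%:Z + 2 == - s%:Z) = false by lia.
by rewrite andbF mul0r addr0.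
Qed.

(** For k = -1 column 0 of the transformed matrix is zero: neither -1 - i nor i + 1 vanishes for i
    >= 0. *)
Lemma det_path_mx_neg1 (R : comNzRingType) (x y t : R) (n : nat) :
  (0 < n)%N -> \det (path_mx x y t n (-1)) = 0.
Proof.
move=> n_gt0; rewrite det_path_mx (expand_det_col _ (Ordinal n_gt0)) big1 // => i _.
rewrite mxE /sym_coef /= !mul0r !addr0.
have -> : (-1 - i%:Z == 0) = false by lia.
have -> : (-1 + i%:Z + 2 == 0) = false by lia.
by rewrite mulr0 subr0 mul0r.
Qed.

Theorem theorem8 (n : nat) (n_gt0 : (0 < n)%N) :
  let x : {mpoly int[3]} := 'X_0 in
  let y : {mpoly int[3]} := 'X_1 in
  let t : {mpoly int[3]} := 'X_(2%:R) in
  (forall k : nat,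
     (forall n1 : nat, n = (n1 * k.+1)%N ->
        \det (path_mx x y t n k%:Z) =
          (-1) ^+ (n1 * 'C(k.+1, 2)) * t ^+ (k * n1./2)
            * (x * y) ^+ (k.+1 ^ 2 * 'C(n1, 2)))
     /\ (~~ (k.+1 %| n)%N -> \det (path_mx x y t n k%:Z) = 0))
  /\ \det (path_mx x y t n (-1)) = 0.
Proof.
move=> x y t; split=> [k|]; last exact: det_path_mx_neg1.
by rewrite det_path_mx_nat; split=> [n1 ->|]; [exact: reduced_det_mul|exact: reduced_det_ndvd].
Qed.
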